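(* Let $f,g_1,\dots,g_m\in\mathbb{R}[x_1,\dots,x_n]$ and $K=\{\mathbf{x}\in\mathbb{R}^n : g_j(\mathbf{x})\ge 0,\ j=1,\dots,m\}$. Assume that $K$ is nonempty and compact, that $0\le g_j(\mathbf{x})\le 1$ for all $\mathbf{x}\in K$ and all $j$, and that the family $\{g_1,\dots,g_m,1-g_1,\dots,1-g_m\}$ generates the $\mathbb{R}$-algebra $\mathbb{R}[x_1,\dots,x_n]$. Let $f_K^\star=\inf_{\mathbf{x}\in K}f(\mathbf{x})$. Assume that Slater's condition holds, i.e. there is $\mathbf{x}_0\in\mathbb{R}^n$ with $g_j(\mathbf{x}_0)>0$ for all $j$. If $f$ and $-g_j$, $j=1,\dots,m$, are SOS-convex polynomials of degree at most $2k$, then $$p_1^k=f_K^\star,$$ where $$p_1^k=\sup\Big\{t\in\mathbb{R} : L_1(\mathbf{x},\boldsymbol\lambda)-t\in(\Sigma+C)_{n,2k}\ \text{for some}\ \boldsymbol\lambda\ge 0\Big\}.$$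
   Context: Notation: $\mathbb{R}[\mathbf{x}]_{n,2k}$ is the space of real polynomials in $n$ variables of degree at most $2k$; $\mathbb{N}$ contains $0$. Lagrange polynomial at level $1$: let $\mathbb{N}^{2m}_1=\{(\mathbf{a},\mathbf{b})\in\mathbb{N}^m\times\mathbb{N}^m : |\mathbf{a}|+|\mathbf{b}|\le 1\}$, with $|\mathbf{a}|=\sum_j a_j$. For a vector $\boldsymbol\lambda=(\lambda_{\mathbf{a}\mathbf{b}})_{(\mathbf{a},\mathbf{b})\in\mathbb{N}^{2m}_1}$ of nonnegative reals, $$L_1(\mathbf{x},\boldsymbol\lambda)=f(\mathbf{x})-\sum_{(\mathbf{a},\mathbf{b})\in\mathbb{N}_1^{2m}}\lambda_{\mathbf{a}\mathbf{b}}\prod_{j=1}^m g_j(\mathbf{x})^{a_j}(1-g_j(\mathbf{x}))^{b_j}.$$ SOS-convexity: a polynomial $h$ is SOS-convex if its Hessian $H(\mathbf{x})$ factors as $M(\mathbf{x})M(\mathbf{x})^\top$ for some (rectangular) polynomial matrix $M$; equivalently, $\mathbf{y}^\top H(\mathbf{x})\mathbf{y}$ is a sum of squares in $\mathbb{R}[\mathbf{x};\mathbf{y}]$. SOS cone: $\Sigma_{n,2k}$ is the set of finite sums of squares of polynomials of degree at most $k$ in $n$ variables. SONC cone: A circuit $(S,\boldsymbol\beta)$ consists of a finite affinely independent set $S\subseteq\mathbb{N}^n$ and a point $\boldsymbol\beta\in\mathbb{N}^n\setminus S$ in the relative interior of $\mathrm{conv}(S)$. A monomial square is a term $c\,\mathbf{x}^{\boldsymbol\alpha}$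 with $c\ge0$ and $\boldsymbol\alpha\in 2\mathbb{N}^n$. A circuit polynomial is a polynomial that is either a sum of monomial squares or of the form $\sum_{\boldsymbol\alpha\in S}c_{\boldsymbol\alpha}\mathbf{x}^{\boldsymbol\alpha}+\delta\,\mathbf{x}^{\boldsymbol\beta}$ with $(S,\boldsymbol\beta)$ a circuit, $S\subseteq 2\mathbb{N}^n$, all $c_{\boldsymbol\alpha}>0$ and $\delta\in\mathbb{R}$. A polynomial is SONC if it is a finite conic combination of circuit polynomials that are nonnegative on $\mathbb{R}^n$. $C_{n,2k}$ is the cone of all SONC polynomials in $\mathbb{R}[\mathbf{x}]_{n,2k}$. SOS+SONC cone: $(\Sigma+C)_{n,2k}=\Sigma_{n,2k}+C_{n,2k}$. *)

(* Defs.v *)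
From HB Require Import structures.
From mathcomp Require Import all_boot all_order all_algebra finmap.
From mathcomp Require Import all_classical all_reals all_analysis.
(* The notations of mpoly clash with those of mathcomp-analysis. *)
From mathcomp Require Export -(notations) mpoly.

Set Implicit Arguments.
Unset Strict Implicit.
Unset Printing Implicit Defensive.

Import Order.TTheory GRing.Theory Num.Theory.
Import numFieldNormedType.Exports.

Local Open Scope classical_set_scope.
Local Open Scope ring_scope.

Notation "{ 'mpoly' T [ n ] }" := (mpoly n T) : type_scope.

Section Polynomials.
Context {R : realType} {n : nat}.
Implicit Types (p h : {mpoly R[n]}) (x : 'rV[R]_n) (a b : multinom n).

Definition peval p x : R := meval (x ord0) p.

(* [mmeasure mdeg p] is [deg p + 1], and [0] when [p = 0]. *)
Definition degree_le (d : nat) p : Prop := (mmeasure mdeg p <= d.+1)%N.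

Definition generates_algebra (G : set {mpoly R[n]}) : Prop :=
  forall S : {pred {mpoly R[n]}}, GRing.subalg_closed S ->
    (forall p, G p -> p \in S) -> forall p, p \in S.

Definition hessian h : 'M[{mpoly R[n]}]_n :=
  \matrix_(i, j) mderiv i (mderiv j h).

Definition sos_convex h : Prop :=
  exists (r : nat) (M : 'M[{mpoly R[n]}]_(n, r)), hessian h = M *m M^T.

Definition sos_cone (k : nat) : set {mpoly R[n]} :=
  [set p | exists s : seq {mpoly R[n]},
     {in s, forall q, degree_le k q} /\ p = \sum_(q <- s) q ^+ 2].

End Polynomials.

Section ConvexGeometry.
Context {R : realType} {n : nat}.
Implicit Types (A : set 'rV[R]_n) (x : 'rV[R]_n).

Definition convex_hull A : set 'rV[R]_n :=
  smallest (@convex_set R ('rV[R]_n)) A.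

Definition affine_hull A : set 'rV[R]_n :=
  [set x | exists (r : nat) (c : 'I_r -> R) (v : 'I_r -> 'rV[R]_n),
     [/\ forall i, A (v i), \sum_i c i = 1 & x = \sum_i c i *: v i]].

(* Interior relative to the affine hull:
   some neighbourhood of [x] meets the affine hull of [A] only inside [A]. *)
Definition relative_interior A : set 'rV[R]_n :=
  [set x | A x /\ within (affine_hull A) (nbhs x) A].

End ConvexGeometry.

Section Circuits.
Context {R : realType} {n : nat}.
Implicit Types (p : {mpoly R[n]}) (a b : multinom n) (S : {fset multinom n}).

Definition exponent_point a : 'rV[R]_n := \row_i (a i)%:R.

Definition affinely_independent S : Prop :=
  forall c : multinom n -> R,
    \sum_(a <- S) c a = 0 -> \sum_(a <- S) c a *: exponent_point a = 0 ->
    {in S, forall a, c a = 0}.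

Definition circuit S b : Prop :=
  [/\ affinely_independent S, b \notin S
    & relative_interior (convex_hull (exponent_point @` [set` S]))
        (exponent_point b)].

Definition even_exponent a : Prop := forall i, ~~ odd (a i).

Definition sum_monomial_squares p : Prop :=
  exists s : seq (R * multinom n),
    {in s, forall t, 0 <= t.1 /\ even_exponent t.2} /\
    p = \sum_(t <- s) t.1 *: mpolyX R t.2.

Definition circuit_polynomial p : Prop :=
  sum_monomial_squares p \/
  exists S b (c : multinom n -> R) (delta : R),
    [/\ circuit S b,
        {in S, forall a, even_exponent a},
        {in S, forall a, 0 < c a}
      & p = \sum_(a <- S) c a *: mpolyX R a + delta *: mpolyX R b].

Definition sonc p : Prop :=
  exists s : seq (R * {mpoly R[n]}),
    {in s, forall t, [/\ 0 <= t.1, circuit_polynomial t.2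
                       & forall x, 0 <= peval t.2 x]} /\
    p = \sum_(t <- s) t.1 *: t.2.

Definition sonc_cone (d : nat) : set {mpoly R[n]} :=
  [set p | sonc p /\ degree_le d p].

Definition sos_sonc_cone (k : nat) : set {mpoly R[n]} :=
  [set p | exists u v, [/\ sos_cone k u, sonc_cone (2 * k) v & p = u + v]].

End Circuits.

Arguments affinely_independent R {n} S.
Arguments circuit R {n} S b.

Section Optimization.
Context {R : realType} {n m : nat}.
Implicit Types (f : {mpoly R[n]}) (g : 'I_m -> {mpoly R[n]})
  (lambda : multinom m -> multinom m -> R).

Definition feasible_set g : set 'rV[R]_n :=
  [set x | forall j, 0 <= peval (g j) x].

Definition infimum_on (A : set 'rV[R]_n) f : \bar R :=
  ereal_inf [set (peval f x)%:E | x in A].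

(* [bmultinom m d.+1] is the finite type of multi-indices of degree at most
   [d], so that the sum ranges over all (a, b) with |a| + |b| <= d. *)
Definition lagrange (d : nat) f g lambda : {mpoly R[n]} :=
  f - \sum_(ab : bmultinom m d.+1 * bmultinom m d.+1
              | (mdeg ab.1 + mdeg ab.2 <= d)%N)
        lambda ab.1 ab.2 *:
          \prod_(j < m) (g j ^+ ab.1 j * (1 - g j) ^+ ab.2 j).

Definition multiplier_ge0 (d : nat) lambda : Prop :=
  forall a b, (mdeg a + mdeg b <= d)%N -> 0 <= lambda a b.

Definition lagrange_bound (d k : nat) f g : \bar R :=
  ereal_sup [set t%:E | t in
    [set t : R | exists lambda, multiplier_ge0 d lambda /\
       sos_sonc_cone k (lagrange d f g lambda - mpolyC n t)]].

End Optimization.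

(* Main.v *)
From HB Require Import structures.
Require Import Defs.
From mathcomp Require Import all_boot all_order all_algebra.
From mathcomp Require Import all_classical all_reals all_analysis.
From mathcomp Require Import ring lra zify polyrcf.

Import Order.TTheory GRing.Theory Num.Theory.
Import numFieldNormedType.Exports.

(** The bound is at most the minimum because every product of the [g j] and
the [1 - g j] is nonnegative on the feasible set, so that a Lagrange polynomial
never exceeds [f] there, while SOS and SONC polynomials are nonnegative
everywhere ([lagrange_le], [sos_sonc_ge0]).

For the converse, let [u] be a minimizer of [f] on the compact feasible set.
SOS-convex polynomials are convex functions, so Slater's condition gives
multipliers [l j >= 0] for which [L = f - f(u) - sum_j l j * g j] is nonnegative
on the whole space ([slater_multipliers]).  Feasibility of [u] forces
[L(u) = 0]: [u] is a global minimizer of [L], and its gradient vanishes there.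
As [L] is again SOS-convex, it suffices to know that an SOS-convex polynomial
with a zero of order two at [u] is a sum of squares.  This is Taylor's formula
with integral remainder

    h(x) = h(u) + grad h(u) . (x - u)
           + int_0^1 (1 - s) (x - u)^T H(u + s (x - u)) (x - u) ds,

whose integrand is a sum of squares of polynomials in [x] and [s] as soon as
[H = M M^T].  Integrating the square of [sum_i q_i(x) s^i] against [1 - s]
yields a quadratic form in the [q_i] whose matrix, with entries
[1 / ((i + j + 1) (i + j + 2))], is positive semidefinite; diagonalizing it
turns the remainder into an honest finite sum of squares of polynomials
([psd_form_sos], [remainder1_sos], [sos_convex_remainder]).  The same
formula gives the tangent inequality and hence the convexity used above.
Finally, leading terms of squares cannot cancel, so the squares have degree at
most [k] ([degree_le_sum_sqr]); the SONC summand is zero. *)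

Set Implicit Arguments.
Unset Strict Implicit.
Unset Printing Implicit Defensive.

Local Open Scope classical_set_scope.
Local Open Scope ring_scope.

(** * Positive semidefinite forms in a commutative algebra *)

Definition quad_form (R : comNzRingType) (A : comAlgType R) (N : nat)
    (W : nat -> nat -> R) (q : nat -> A) : A :=
  \sum_(i < N) \sum_(j < N) W i j *: (q i * q j).

Definition schur (R : fieldType) (W : nat -> nat -> R) (i j : nat) : R :=
  W i.+1 j.+1 - W 0%N i.+1 * W 0%N j.+1 / W 0%N 0%N.

Lemma quad_form_recl (R : comNzRingType) (A : comAlgType R) N
    (W : nat -> nat -> R) (q : nat -> A) :
  (forall i j, W i j = W j i) ->
  quad_form N.+1 W q =
    W 0%N 0%N *: (q 0%N) ^+ 2
    + (q 0%N * \sum_(j < N) W 0%N j.+1 *: q j.+1) *+ 2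
    + quad_form N (fun i j => W i.+1 j.+1) (q \o S).
Proof.
move=> Wsym; rewrite /quad_form big_ord_recl big_ord_recl /= -expr2.
under [X in _ + X = _]eq_bigr => i _ do rewrite big_ord_recl.
rewrite big_split /= [in RHS]mulr2n !addrA; congr (_ + _).
rewrite mulr_sumr; congr (_ + _ + _); apply: eq_bigr => i _.
  by rewrite scalerAr.
by rewrite /bump /= !add1n Wsym mulrC scalerAr.
Qed.

(** Completing the square in [q 0]; the Schur complement collects what is left
of the form in the remaining elements. *)
Lemma quad_form_square (R : fieldType) (A : comAlgType R) N
    (W : nat -> nat -> R) (q : nat -> A) :
  (forall i j, W i j = W j i) -> W 0%N 0%N != 0 ->
  quad_form N.+1 W q =
    W 0%N 0%N *:
      (q 0%N + (W 0%N 0%N)^-1 *: \sum_(j < N) W 0%N j.+1 *: q j.+1) ^+ 2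
    + quad_form N (schur W) (q \o S).
Proof.
move=> Wsym W0; rewrite quad_form_recl //.
set S := \sum_(j < N) _.
have -> : quad_form N (schur W) (q \o succn) =
    quad_form N (fun i j => W i.+1 j.+1) (q \o succn)
      - (W 0%N 0%N)^-1 *: S ^+ 2.
  rewrite expr2 {1}/S mulr_suml scaler_sumr /quad_form -sumrB.
  apply: eq_bigr => i _; rewrite /S mulr_sumr scaler_sumr -sumrB.
  apply: eq_bigr => j _; rewrite scalerBl; congr (_ - _).
  by rewrite -scalerAl -scalerAr !scalerA mulrC mulrA.
have -> : W 0%N 0%N *: (q 0%N + (W 0%N 0%N)^-1 *: S) ^+ 2 =
    W 0%N 0%N *: q 0%N ^+ 2 + q 0%N * S *+ 2 + (W 0%N 0%N)^-1 *: S ^+ 2.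
  rewrite sqrrD exprZn -[q 0%N * (_ *: _)]scalerAr 2!scalerDr scalerA.
  rewrite [_^-1 ^+ 2]expr2 mulrA mulfV // mul1r; congr (_ + _ + _).
  by rewrite -scalerMnr scalerA mulfV // scale1r.
by rewrite [in RHS]addrACA addrN addr0.
Qed.

(** Cholesky elimination: positivity is tested on real vectors only, but the
elimination is a polynomial identity, so it applies to the elements of any
commutative algebra.  The Schur complement is again positive semidefinite,
because its value at [c] is the value of the whole form at [c] extended by the
first coordinate that annihilates the completed square. *)
Lemma psd_form_sos (R : rcfType) (A : comAlgType R) N (W : nat -> nat -> R) :
  (forall i j, W i j = W j i) ->
  (forall c : nat -> R^o, 0 <= quad_form N W c :> R) ->
  forall q : nat -> A, exists s : seq A, quad_form N W q = \sum_(y <- s) y ^+ 2.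
Proof.
elim: N W => [|N IHN] W Wsym Wpsd q.
  by exists [::]; rewrite big_nil /quad_form big_ord0.
have W00_ge0 : 0 <= W 0%N 0%N.
  have := Wpsd (fun i => (i == 0%N)%:R).
  rewrite quad_form_recl // expr1n /quad_form !big1 ?mulr0 ?mul0rn ?addr0.
  - by rewrite /= /GRing.scale /= mulr1.
  - by move=> i _; rewrite big1 // => j _; rewrite mul0r scaler0.
  - by move=> i _; rewrite scaler0.
(* A positive semidefinite form with a zero pivot has a zero first row:
   otherwise it would be affine and nonconstant in the first coordinate. *)
have [W00|W00] := eqVneq (W 0%N 0%N) 0.
  have W0 i : (i < N)%N -> W 0%N i.+1 = 0.
    move=> ltiN; set a := W 0%N i.+1; set b := W i.+1 i.+1.
    have Wt t : 0 <= (t * a) *+ 2 + b.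
      have := Wpsd (fun j => if j is j'.+1 then (j' == i)%:R else t).
      rewrite quad_form_recl // W00 scale0r add0r.
      rewrite (bigD1 (Ordinal ltiN)) //= eqxx big1 ?addr0; last first.
        by move=> j; rewrite -val_eqE /= => /negPf ->; rewrite scaler0.
      rewrite /quad_form (bigD1 (Ordinal ltiN)) //= eqxx.
      rewrite [X in _ + (_ + X)]big1 ?addr0; last first.
        move=> j; rewrite -val_eqE /= => /negPf ->.
        by rewrite big1 // => k _; rewrite mul0r scaler0.
      rewrite (bigD1 (Ordinal ltiN)) //= eqxx big1 ?addr0; last first.
        by move=> j; rewrite -val_eqE /= => /negPf ->; rewrite mulr0 scaler0.
      by rewrite /GRing.scale /= !mulr1.
    apply/eqP/negPn/negP => a0.
    (* There the form takes the negative value [b - 2 * (`|b| + 1)]. *)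
    have := Wt (- (`|b| + 1) / a).
    rewrite mulfVK // => h.
    have := ler_norm b; have := normr_ge0 b; lra.
  rewrite quad_form_recl // W00 scale0r add0r big1 ?mulr0 ?mul0rn ?add0r.
    apply: (IHN (fun i j => W i.+1 j.+1)) => [i j|c]; first exact: Wsym.
    have := Wpsd (fun j => if j is j'.+1 then c j' else 0).
    by rewrite quad_form_recl // W00 scale0r add0r mul0r mul0rn add0r.
  by move=> i _; rewrite W0 // scale0r.
have [|c|s sE] := IHN (schur W) _ _ (q \o succn).
- by move=> i j; rewrite /schur Wsym [_ * W 0%N j.+1]mulrC.
- pose S := \sum_(j < N) W 0%N j.+1 *: c j.
  have := Wpsd (fun j => if j is j'.+1 then c j' else - ((W 0%N 0%N)^-1 *: S)).
  by rewrite quad_form_square // addNr expr0n scaler0 add0r.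
rewrite quad_form_square // sE.
set y := (X in X ^+ 2).
exists (Num.sqrt (W 0%N 0%N) *: y :: s).
by rewrite big_cons exprZn sqr_sqrtr.
Qed.

(** * Taylor remainder of order one of a polynomial *)

Definition remainder1 (A : nzRingType) (P : {poly A}) : A :=
  P.[1] - P.[0] - P^`().[0].

(** The integral of [(1 - s) * s ^ j] over the unit interval. *)
Definition taylor_weight (R : fieldType) (j : nat) : R :=
  (j.+1 * j.+2)%:R^-1.

(** A second primitive of the square of [\poly_(i < N) c i]. *)
Definition sqr_primitive2 (R : fieldType) (A : algType R) N (c : nat -> A) :
    {poly A} :=
  \sum_(i < N) \sum_(j < N)
    (taylor_weight R (i + j) *: (c i * c j)) *: 'X^((i + j).+2).

Lemma remainder1D (A : comNzRingType) (P Q : {poly A}) :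
  remainder1 (P + Q) = remainder1 P + remainder1 Q.
Proof. by rewrite /remainder1 derivD !hornerD; ring. Qed.

Lemma remainder1_sum (A : comNzRingType) (I : Type) (r : seq I)
    (F : I -> {poly A}) :
  remainder1 (\sum_(i <- r) F i) = \sum_(i <- r) remainder1 (F i).
Proof.
apply: (big_morph _ (@remainder1D A)).
by rewrite /remainder1 deriv0 !horner0 !subr0.
Qed.

Lemma remainder1ZXn (A : comNzRingType) (a : A) j :
  remainder1 (a *: 'X^(j.+2)) = a.
Proof.
rewrite /remainder1 derivZ derivXn !(hornerZ, hornerMn, hornerXn) expr1n.
by rewrite !expr0n /= mul0rn mulr1 !mulr0 !subr0.
Qed.

(** In characteristic zero, two polynomials with the same second derivative
differ by an affine one, and affine polynomials have no remainder. *)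
Lemma remainder1_eq (R : numFieldType) (A : comAlgType R) (P Q : {poly A}) :
  P^`()^`() = Q^`()^`() -> remainder1 P = remainder1 Q.
Proof.
move=> PQ; apply/eqP; rewrite -subr_eq0; apply/eqP.
suff -> : remainder1 P - remainder1 Q = remainder1 (P - Q).
  have {PQ} DD : (P - Q)^`()^`() = 0 by rewrite !derivB PQ subrr.
  move: (P - Q) DD => D DD.
  have D0 i : D`_i.+2 = 0.
    have := congr1 (coefp i) DD; rewrite /coefp !coef_deriv coef0 -mulrnA.
    move=> /(congr1 (fun a : A => ((i.+2 * i.+1)%:R : R)^-1 *: a)).
    by rewrite scaler0 -[D`__ *+ _](@scaler_nat R) scalerA mulVf ?scale1r //.
  have -> : D = (D`_0)%:P + D`_1 *: 'X.
    apply/polyP=> -[|[|i]]; rewrite !(coefD, coefZ, coefC, coefX) /=;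
    by rewrite ?D0 ?mulr0 ?mulr1 ?addr0 ?add0r.
  rewrite /remainder1 !(derivD, derivZ, derivC, derivX, poly.derivE) !hornerE.
  ring.
by rewrite /remainder1 derivB !hornerD !hornerN; ring.
Qed.

Lemma deriv2_sqr_primitive2 (R : numFieldType) (A : comAlgType R) N
    (c : nat -> A) :
  (sqr_primitive2 N c)^`()^`() = (\poly_(i < N) c i) ^+ 2.
Proof.
rewrite /sqr_primitive2 poly_def expr2 !raddf_sum /=.
rewrite mulr_suml; apply: eq_bigr => i _.
rewrite !raddf_sum mulr_sumr; apply: eq_bigr => j _ /=.
rewrite !derivZ derivXn derivMn derivXn /= -mulrnA.
rewrite -scalerAl -scalerAr scalerA -exprD.
rewrite -[LHS]scalerMnr scalerMnl; congr (_ *: _).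
by rewrite -[LHS](@scaler_nat R) scalerA /taylor_weight mulfV ?scale1r.
Qed.

Lemma remainder1_sqr_primitive2 (R : numFieldType) (A : comAlgType R) N
    (c : nat -> A) :
  remainder1 (sqr_primitive2 N c) =
    quad_form N (fun i j => taylor_weight R (i + j)) c.
Proof.
rewrite /sqr_primitive2 remainder1_sum; apply: eq_bigr => i _.
by rewrite remainder1_sum; apply: eq_bigr => j _; rewrite remainder1ZXn.
Qed.

Lemma remainder1_ge0 (R : rcfType) (P : {poly R}) :
  (forall x, 0 <= P^`()^`().[x]) -> 0 <= remainder1 P.
Proof.
move=> P2; have [c /andP[c0 _] Pc] := poly_mvt P (@ltr01 R).
have [d _ Pd] := poly_mvt P^`() c0.
rewrite /remainder1 Pc !subr0 mulr1 Pd subr0.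
by rewrite mulr_ge0 // ltW.
Qed.

(** The form is the integral of [(1 - s) * c(s) ^ 2], that is the remainder at
order one of a polynomial whose second derivative is a square. *)
Lemma taylor_weight_psd (R : rcfType) N (c : nat -> R^o) :
  0 <= quad_form N (fun i j => taylor_weight R (i + j)) c :> R.
Proof.
rewrite -remainder1_sqr_primitive2; apply: remainder1_ge0 => x.
by rewrite deriv2_sqr_primitive2 horner_exp sqr_ge0.
Qed.

(** Over the algebra [A] the remainder still depends on the second derivative
only, so it is computed on the explicit second primitives of the squares, where
it is a positive semidefinite form in the coefficients. *)
Lemma remainder1_sos (R : rcfType) (A : comAlgType R) (P : {poly A})
    (Qs : seq {poly A}) :
  P^`()^`() = \sum_(Q <- Qs) Q ^+ 2 ->
  exists s : seq A, remainder1 P = \sum_(y <- s) y ^+ 2.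
Proof.
move=> P2; pose D (Q : {poly A}) := sqr_primitive2 (size Q) (nth 0 Q).
have -> : remainder1 P = remainder1 (\sum_(Q <- Qs) D Q).
  apply: remainder1_eq; rewrite P2 !raddf_sum; apply: eq_bigr => Q _ /=.
  by rewrite deriv2_sqr_primitive2 coefK.
rewrite remainder1_sum; elim: Qs {P2} => [|Q Qs [s IHs]].
  by exists [::]; rewrite !big_nil.
have [||t tE] := @psd_form_sos R A (size Q)
    (fun i j => taylor_weight R (i + j)) _ _ (nth 0 Q).
- by move=> i j; rewrite addnC.
- exact: taylor_weight_psd.
by exists (t ++ s); rewrite big_cons big_cat remainder1_sqr_primitive2 tE IHs.
Qed.

(** * Restricting a polynomial to a segment *)

Local Notation mvar R i := (mpolyX R (mnm1 i)).

Lemma mpoly_ring_ind (R : nzRingType) n (P : {mpoly R[n]} -> Prop) :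
  (forall c, P (mpolyC n c)) -> (forall i, P (mvar R i)) ->
  (forall p q, P p -> P q -> P (p + q)) ->
  (forall p q, P p -> P q -> P (p * q)) -> forall p, P p.
Proof.
move=> PC PX PD PM; elim/mpolyind => [|c m p _ _ Pp]; first by rewrite -mpolyC0.
apply: PD => //; rewrite -mul_mpolyC; apply: (PM) => //.
rewrite mpolyXE_id; elim/big_ind: _ => [|x y Px Py|i _].
- by rewrite -mpolyC1.
- exact: (PM).
by elim: (m i) => [|k IHk]; rewrite ?expr0 -?mpolyC1 ?exprS //; apply: (PM).
Qed.

Definition shift_var (R : nzRingType) n (u : 'I_n -> R) (i : 'I_n) :
    {mpoly R[n]} :=
  mvar R i - mpolyC n (u i).

Lemma mderivU (R : nzRingType) n (i j : 'I_n) :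
  mderiv i (mvar R j) = (i == j)%:R :> {mpoly R[n]}.
Proof.
rewrite mderivX mnm1E eq_sym; case: eqVneq => [->|_]; last by rewrite scale0r.
rewrite scale1r -mpolyX0; congr (mpolyX R _).
by apply/mnmP => k; rewrite mnmBE subnn mnm0E.
Qed.

(** The polynomial [h(u + s (x - u))] in [s], with coefficients polynomial in
[x]. *)
HB.lock Definition along_segment (R : nzRingType) n (u : 'I_n -> R)
    (h : {mpoly R[n]}) : {poly {mpoly R[n]}} :=
  mmap (polyC \o @mpolyC n R)
    (fun i => (mpolyC n (u i))%:P + (shift_var u i)%:P * 'X) h.

Section Segment.
Variables (R : comNzRingType) (n : nat) (u : 'I_n -> R).
Implicit Types h p q : {mpoly R[n]}.

Lemma along_segmentC c : along_segment u (mpolyC n c) = (mpolyC n c)%:P.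
Proof. rewrite along_segment.unlock; exact: mmapC. Qed.

Lemma along_segmentX i :
  along_segment u (mvar R i) = (mpolyC n (u i))%:P + (shift_var u i)%:P * 'X.
Proof. by rewrite along_segment.unlock mmapX mmap1U. Qed.

Lemma along_segmentD p q :
  along_segment u (p + q) = along_segment u p + along_segment u q.
Proof. rewrite along_segment.unlock; exact: mmapD. Qed.

Lemma along_segmentM p q :
  along_segment u (p * q) = along_segment u p * along_segment u q.
Proof. rewrite along_segment.unlock; exact: rmorphM. Qed.

Lemma along_segment_sum (I : Type) (r : seq I) (F : I -> {mpoly R[n]}) :
  along_segment u (\sum_(i <- r) F i) = \sum_(i <- r) along_segment u (F i).
Proof.
apply: (big_morph _ along_segmentD).
by rewrite -mpolyC0 along_segmentC mpolyC0.
Qed.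

Lemma along_segment_at0 h : (along_segment u h).[0] = mpolyC n (meval u h).
Proof.
elim/mpoly_ring_ind: h => [c|i|p q Pp Pq|p q Pp Pq].
- by rewrite along_segmentC hornerC mevalC.
- by rewrite along_segmentX !hornerE mevalXU; rewrite ?mulr0 ?addr0.
- by rewrite along_segmentD hornerD Pp Pq mevalD mpolyCD.
- by rewrite along_segmentM hornerM Pp Pq mevalM mpolyCM.
Qed.

Lemma along_segment_at1 h : (along_segment u h).[1] = h.
Proof.
elim/mpoly_ring_ind: h => [c|i|p q Pp Pq|p q Pp Pq].
- by rewrite along_segmentC hornerC.
- by rewrite along_segmentX hornerD hornerM !hornerC hornerX mulr1 addrC subrK.
- by rewrite along_segmentD hornerD Pp Pq.
- by rewrite along_segmentM hornerM Pp Pq.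
Qed.

(** The chain rule. *)
Lemma deriv_along_segment h :
  (along_segment u h)^`() =
    \sum_i (shift_var u i)%:P * along_segment u (mderiv i h).
Proof.
elim/mpoly_ring_ind: h => [c|i|p q Pp Pq|p q Pp Pq].
- rewrite along_segmentC derivC big1 // => i _.
  by rewrite mderivC -mpolyC0 along_segmentC mpolyC0 mulr0.
- rewrite along_segmentX derivD derivM !derivC derivX mul0r !add0r mulr1.
  rewrite (bigD1 i) //= mderivU eqxx -mpolyC1 along_segmentC mpolyC1 mulr1.
  rewrite big1 ?addr0 // => j /negPf ij.
  by rewrite mderivU ij mulr0n -mpolyC0 along_segmentC mpolyC0 mulr0.
- rewrite along_segmentD derivD Pp Pq -big_split; apply: eq_bigr => i _ /=.
  by rewrite mderivD along_segmentD mulrDr.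
- rewrite along_segmentM derivM Pp Pq mulr_suml mulr_sumr -big_split.
  apply: eq_bigr => i _ /=.
  rewrite mderivM along_segmentD !along_segmentM mulrDr.
  by rewrite [in LHS]mulrCA [in RHS]mulrA.
Qed.

End Segment.

(** Along the segment from [u] to [x], the second derivative of [h] is
[(x - u)^T M M^T (x - u)], the sum over the columns [l] of [M] of the squares
of the polynomials [Q l]; hence the Taylor remainder is a sum of squares. *)
Lemma sos_convex_remainder (R : realType) n (h : {mpoly R[n]}) (u : 'I_n -> R) :
  sos_convex h ->
  exists s : seq {mpoly R[n]},
    h = mpolyC n (meval u h)
        + \sum_i meval u (mderiv i h) *: shift_var u i
        + \sum_(y <- s) y ^+ 2.
Proof.
case=> r [M hM]; pose P := along_segment u h.
pose Q l : {poly {mpoly R[n]}} :=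
  \sum_i (shift_var u i)%:P * along_segment u (M i l).
have [|s sE] := @remainder1_sos R {mpoly R[n]} P [seq Q l | l <- enum 'I_r].
  rewrite big_map big_enum /P deriv_along_segment raddf_sum /=.
  under [RHS]eq_bigr => l _ do rewrite expr2 mulr_suml.
  rewrite exchange_big; apply: eq_bigr => i _ /=.
  rewrite derivM derivC mul0r add0r deriv_along_segment mulr_sumr.
  under [RHS]eq_bigr => l _ do rewrite mulr_sumr.
  rewrite exchange_big; apply: eq_bigr => j _ /=.
  have -> : mderiv j (mderiv i h) = \sum_l M i l * M j l.
    have := congr1 (fun H : 'M[{mpoly R[n]}]_n => H j i) hM; rewrite !mxE => ->.
    by apply: eq_bigr => l _; rewrite !mxE mulrC.
  rewrite along_segment_sum !mulr_sumr.
  by apply: eq_bigr => l _; rewrite along_segmentM [RHS]mulrACA -mulrA.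
exists s; rewrite -sE /remainder1 along_segment_at1 along_segment_at0.
rewrite deriv_along_segment horner_sum.
under [X in _ + (_ - X)]eq_bigr => i _ do
  rewrite hornerM hornerC along_segment_at0 mulrC mul_mpolyC.
by rewrite -[_ - _ - _]addrA -opprD addrC addNKr.
Qed.

(** * Convex duality under Slater's condition *)

(** A multiplier is a real number lying between the slopes [- F x / h x] over
the points where [h] is positive and [F y / - h y] over those where [h] is
negative.  The former never exceed the latter, since on the segment from [x] to
[y] the function [h] is nonpositive at the point that balances [h x] against
[h y], and there [F] is nonnegative.  The point [x0] makes the second family
nonempty, hence the supremum of the first one finite. *)
Lemma convex_single_multiplier (R : realType) (E : lmodType R)
    (C : set (convex_lmodType E)) (F h : convex_lmodType E -> R^o) (x0 : E) :
  convex_set C -> convex_function C F -> convex_function C h ->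
  C x0 -> h x0 < 0 -> (forall x, C x -> h x <= 0 -> 0 <= F x) ->
  exists2 l : R, 0 <= l & forall x, C x -> 0 <= F x + l * h x.
Proof.
move=> Cconv Fconv hconv Cx0 hx0 F_ge0.
have slope x y : C x -> C y -> 0 < h x -> h y < 0 ->
    - F x / h x <= F y / - h y.
  move=> Cx Cy hx hy; have hxy : 0 < h x - h y by lra.
  (* The weight that makes the average of [h x] and [h y] vanish. *)
  pose t := - h y / (h x - h y).
  have t0 : 0 <= t by rewrite divr_ge0; lra.
  have t1 : t <= 1 by rewrite ler_pdivrMr // mul1r; lra.
  have tE : 1 - t = h x / (h x - h y) by rewrite /t; field; rewrite gt_eqF.
  pose z := conv (Itv01 t0 t1) (x : convex_lmodType E) y.
  have /set_mem Cz : z \in C by apply: Cconv; rewrite inE.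
  have hz : h z <= t * h x + (1 - t) * h y.
    by have := hconv (Itv01 t0 t1) x y; rewrite convRE !inE; apply.
  have Fz : F z <= t * F x + (1 - t) * F y.
    by have := Fconv (Itv01 t0 t1) x y; rewrite convRE !inE; apply.
  have hz0 : h z <= 0.
    apply: le_trans hz _; rewrite tE /t.
    have -> : - h y / (h x - h y) * h x + h x / (h x - h y) * h y = 0 by ring.
    by [].
  have Fz0 := F_ge0 z Cz hz0.
  rewrite ler_pdivrMr // mulrAC ler_pdivlMr ?oppr_gt0 //.
  have := le_trans Fz0 Fz; rewrite tE /t.
  have -> : - h y / (h x - h y) * F x + h x / (h x - h y) * F y =
    (- h y * F x + h x * F y) / (h x - h y) by ring.
  rewrite pmulr_lge0 ?invr_gt0 //; lra.
(* The value [0] makes the supremum nonnegative. *)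
pose L : set R := [set 0] `|` [set - F x / h x | x in [set x | C x /\ 0 < h x]].
have L_ub y : C y -> h y < 0 -> ubound L (F y / - h y).
  move=> Cy hy _ [->|[x [Cx hx] <-]]; last exact: slope.
  by rewrite divr_ge0 ?oppr_ge0 ?F_ge0 ?ltW.
have L_sup : has_sup L.
  by split; [exists 0; left | exists (F x0 / - h x0); exact: L_ub].
exists (sup L); first by apply: sup_upper_bound => //; left.
move=> x Cx; case: (ltgtP (h x) 0) => [hx|hx|hx].
- have := sup_le_ub (proj1 L_sup) (L_ub x Cx hx).
  rewrite ler_pdivlMr ?oppr_gt0 //; lra.
- have : - F x / h x <= sup L by apply: sup_upper_bound => //; right; exists x.
  rewrite ler_pdivrMr //; lra.
- by rewrite hx mulr0 addr0 F_ge0 // hx.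
Qed.

Lemma convex_functionD (R : realType) (E : lmodType R)
    (C : set (convex_lmodType E)) (F G : convex_lmodType E -> R^o) :
  convex_function C F -> convex_function C G ->
  convex_function C (fun x => F x + G x : R^o).
Proof.
move=> Fc Gc t x y Cx Cy; have := lerD (Fc t x y Cx Cy) (Gc t x y Cx Cy).
rewrite !convRE; lra.
Qed.

Lemma convex_functionZ (R : realType) (E : lmodType R)
    (C : set (convex_lmodType E)) (l : R) (F : convex_lmodType E -> R^o) :
  0 <= l -> convex_function C F -> convex_function C (fun x => l * F x : R^o).
Proof.
move=> l0 Fc t x y Cx Cy; have := ler_wpM2l l0 (Fc t x y Cx Cy).
rewrite !convRE; lra.
Qed.

Lemma convex_function_sum (R : realType) (E : lmodType R)
    (C : set (convex_lmodType E)) (I : finType)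
    (F : I -> convex_lmodType E -> R^o) :
  (forall i, convex_function C (F i)) ->
  convex_function C (fun x => \sum_i F i x : R^o).
Proof.
move=> Fc t x y Cx Cy; rewrite convRE !mulr_sumr -big_split /=.
by apply: ler_sum => i _; have := Fc i t x y Cx Cy; rewrite convRE.
Qed.

(** Lagrange duality for convex functions under Slater's condition, one
constraint at a time: the multipliers of the last constraints are found on the
convex set where the first one holds, and the resulting Lagrangian then has a
single constraint left.  Quantifying over the convex set [C] is what makes this
induction go through. *)
Lemma slater_multipliers (R : realType) (E : lmodType R) (m : nat)
    (C : set (convex_lmodType E)) (F : convex_lmodType E -> R^o)
    (h : 'I_m -> convex_lmodType E -> R^o) (x0 : E) :
  convex_set C -> convex_function C F -> (forall j, convex_function C (h j)) ->
  C x0 -> (forall j, h j x0 < 0) ->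
  (forall x, C x -> (forall j, h j x <= 0) -> 0 <= F x) ->
  exists2 l : 'I_m -> R, forall j, 0 <= l j &
    forall x, C x -> 0 <= F x + \sum_j l j * h j x.
Proof.
elim: m C h => [|m IHm] C h Cconv Fconv hconv Cx0 hx0 F_ge0.
  by exists (fun=> 0) => // x Cx;
    rewrite big_ord0 addr0; apply: F_ge0 => // -[].
pose C' := C `&` [set x | h ord0 x <= 0].
have sub A (f : convex_lmodType E -> R^o) :
    A `<=` C -> convex_function C f -> convex_function A f.
  move=> sAC fc t x y; rewrite !inE => Ax Ay.
  by apply: fc; rewrite inE; apply: sAC.
have C'C : C' `<=` C by move=> x [].
have [|||||x [Cx h0x] hjx|l l_ge0 Fl] := IHm C' (fun j => h (lift ord0 j)).
- move=> x y t; rewrite !inE => -[Cx hx] [Cy hy]; split.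
    by have := Cconv x y t; rewrite !inE; apply.
  have := hconv ord0 t x y; rewrite !inE => /(_ Cx Cy).
  move=> /le_trans; apply; rewrite convRE.
  rewrite -oppr_ge0 opprD addr_ge0 // -mulrN mulr_ge0 ?oppr_ge0 //.
  by rewrite subr_ge0; exact: le1.
- exact: sub C'C Fconv.
- by move=> j; exact: sub C'C (hconv _).
- by split=> //; exact: ltW.
- by move=> j; exact: hx0.
- by apply: F_ge0 => // j; case: (unliftP ord0 j) => [k ->|->].
have [//||//|//|//||l0 l0_ge0 Fl0] := @convex_single_multiplier R E C
    (fun x => F x + \sum_j l j * h (lift ord0 j) x) (h ord0) x0.
- apply: convex_functionD => //; apply: convex_function_sum => j.
  exact: convex_functionZ.
- by move=> x Cx hx; apply: Fl.
exists (fun j => oapp l l0 (unlift ord0 j)).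
  by move=> j; case: unliftP => [k _|_] /=.
move=> x Cx; rewrite big_ord_recl unlift_none /= addrCA addrC.
under eq_bigr => j _ do rewrite liftK /=.
exact: Fl0.
Qed.

(** * SOS-convex polynomials *)

(** If [P = P(0) + Q * 'X], then [t * Q(t)] is nonnegative for all [t], so that
[Q(0)], which is the derivative at [0], can have neither sign. *)
Lemma poly_min_deriv0 (R : rcfType) (P : {poly R}) :
  (forall t, P.[0] <= P.[t]) -> P^`().[0] = 0.
Proof.
move=> Pmin.
have /factor_theorem[Q PQ] : root (P - P.[0]%:P) 0.
  by rewrite rootE hornerD hornerN hornerC subrr.
have PE : P = Q * 'X + P.[0]%:P by rewrite -[LHS](subrK P.[0]%:P) PQ subr0.
have -> : P^`().[0] = Q.[0].
  rewrite PE derivD derivC derivM derivX mulr1 addr0.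
  by rewrite hornerD hornerM hornerX mulr0 add0r.
have QX t : 0 <= Q.[t] * t.
  by have := Pmin t; rewrite {2}PE hornerD hornerC hornerM hornerX; lra.
apply/eqP/negPn/negP => Q0.
have [|d d0 Qd] := @poly_cont R 0 Q `|Q.[0]|; first by rewrite normr_gt0.
have [Q0p|Q0n|/eqP] := ltgtP Q.[0] 0; last by rewrite (negPf Q0).
- have := Qd (d / 2); rewrite subr0 ger0_norm; last by lra.
  have := QX (d / 2); rewrite pmulr_lge0; last by lra.
  rewrite (ltr0_norm Q0p) => Q2 /(_ ltac:(lra)).
  by rewrite ltr_norml => /andP[_]; lra.
- have := Qd (- d / 2); rewrite subr0 ler0_norm; last by lra.
  have := QX (- d / 2); rewrite nmulr_lge0; last by lra.
  rewrite (gtr0_norm Q0n) => Q2 /(_ ltac:(lra)).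
  by rewrite ltr_norml => /andP[+ _]; lra.
Qed.

Section SosConvex.
Variables (R : realType) (n : nat).
Implicit Types (h p q : {mpoly R[n]}) (u v : 'I_n -> R).

Lemma meval_sum_sqr_ge0 (s : seq {mpoly R[n]}) v :
  0 <= meval v (\sum_(y <- s) y ^+ 2).
Proof.
by rewrite raddf_sum; apply: sumr_ge0 => y _; rewrite /= rmorphXn sqr_ge0.
Qed.

Lemma sos_convex_tangent h u v : sos_convex h ->
  meval u h + \sum_i meval u (mderiv i h) * (v i - u i) <= meval v h.
Proof.
move=> hc; have [s hE] := sos_convex_remainder u hc.
rewrite [X in _ <= meval v X]hE !mevalD mevalC raddf_sum /=.
have -> : \sum_i meval v (meval u (mderiv i h) *: shift_var u i) =
    \sum_i meval u (mderiv i h) * (v i - u i).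
  by apply: eq_bigr => i _; rewrite mevalZ mevalB mevalXU mevalC.
by rewrite lerDl meval_sum_sqr_ge0.
Qed.

(** The tangent inequalities at the average [z] of [x] and [y], averaged with
the same weights: the linear terms cancel. *)
Lemma sos_convex_convex h : sos_convex h ->
  convex_function setT (peval h : convex_lmodType 'rV[R]_n -> R^o).
Proof.
move=> hc t x y _ _; rewrite convRE /peval.
set z := conv t x y; set u : 'I_n -> R := (z : 'rV[R]_n) ord0.
have t0 : 0 <= t%:num by [].
have t1 : 0 <= unstable.onem t%:num by rewrite subr_ge0; exact: le1.
have := lerD (ler_wpM2l t0 (sos_convex_tangent u (x ord0) hc))
  (ler_wpM2l t1 (sos_convex_tangent u (y ord0) hc)).
apply: le_trans; rewrite !mulrDr addrACA -mulrDl unstable.add_onemK mul1r lerDl.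
rewrite le_eqVlt; apply/orP; left; rewrite eq_sym; apply/eqP.
rewrite (mulr_sumr _ _ _ t%:num) (mulr_sumr _ _ _ (unstable.onem _)).
rewrite -big_split /=.
by rewrite big1 // => i _; rewrite /u !mxE /unstable.onem; ring.
Qed.

Lemma sos_convexC c : sos_convex (mpolyC n c : {mpoly R[n]}).
Proof.
exists 0%N, 0; rewrite mul0mx; apply/matrixP => i j.
by rewrite !mxE mderivC mderiv0.
Qed.

(** Juxtaposing the factors [M] and [N] factors the sum of the Hessians. *)
Lemma sos_convexD p q : sos_convex p -> sos_convex q -> sos_convex (p + q).
Proof.
move=> [r [M pM]] [s [N qN]]; exists (r + s)%N, (row_mx M N).
rewrite tr_row_mx mul_row_col -pM -qN.
by apply/matrixP => i j; rewrite !mxE !mderivD.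
Qed.

Lemma sos_convexZ c p : 0 <= c -> sos_convex p -> sos_convex (c *: p).
Proof.
move=> c0 [r [M pM]]; exists r, (mpolyC n (Num.sqrt c) *: M).
rewrite linearZ /= -scalemxAl -scalemxAr scalerA -mpolyCM -expr2 sqr_sqrtr //.
by rewrite -pM; apply/matrixP => i j; rewrite !mxE !mderivZ mul_mpolyC.
Qed.

Lemma sos_convex_sum (I : Type) (r : seq I) (F : I -> {mpoly R[n]}) :
  (forall i, sos_convex (F i)) -> sos_convex (\sum_(i <- r) F i).
Proof.
move=> Fc; elim/big_rec: _ => [|i p _ pc].
  by rewrite -mpolyC0; exact: sos_convexC.
exact: sos_convexD.
Qed.

Lemma along_segment_eval u v h t :
  (map_poly (meval v) (along_segment u h)).[t] =
    meval (fun i => u i + t * (v i - u i)) h.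
Proof.
elim/mpoly_ring_ind: h => [c|i|p q Pp Pq|p q Pp Pq].
- by rewrite along_segmentC map_polyC hornerC /= !mevalC.
- rewrite along_segmentX rmorphD rmorphM /= !map_polyC map_polyX /=.
  rewrite hornerD hornerM !hornerC hornerX !mevalC !mevalXU mevalB mevalC.
  rewrite mevalXU.
  by rewrite mulrC.
- by rewrite along_segmentD rmorphD hornerD Pp Pq mevalD.
- by rewrite along_segmentM rmorphM hornerM Pp Pq mevalM.
Qed.

(** The restriction of [h] to the line through [u] in direction [i] is a
polynomial in one variable that is minimal at [0]. *)
Lemma mderiv_min h u : (forall v, meval u h <= meval v h) ->
  forall i, meval u (mderiv i h) = 0.
Proof.
move=> hmin i; pose v j := u j + (j == i)%:R.
pose P := map_poly (meval v) (along_segment u h).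
have : P^`().[0] = 0.
  apply: poly_min_deriv0 => t; rewrite !along_segment_eval.
  apply: le_trans (hmin _); rewrite le_eqVlt; apply/orP; left.
  by apply/eqP; apply: meval_eq => j; rewrite mul0r addr0.
rewrite /P deriv_map deriv_along_segment rmorph_sum horner_sum (bigD1 i) //=.
rewrite rmorphM /= map_polyC hornerM hornerC along_segment_eval /=.
rewrite mevalB mevalXU mevalC.
rewrite /v eqxx addrAC subrr add0r mul1r big1 ?addr0.
  by move=> <-; apply: meval_eq => j; rewrite mul0r addr0.
move=> j /negPf ji.
rewrite rmorphM /= map_polyC hornerM hornerC /= mevalB mevalXU mevalC.
by rewrite ji addr0 subrr mul0r.
Qed.

(** At a minimizer where [h] vanishes, the affine part of the Taylor formula is
zero, and only the remainder is left. *)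
Lemma sos_convex_min_sos h u : sos_convex h -> meval u h = 0 ->
  (forall v, 0 <= meval v h) ->
  exists s : seq {mpoly R[n]}, h = \sum_(y <- s) y ^+ 2.
Proof.
move=> hc hu h_ge0; have [s hE] := sos_convex_remainder u hc.
exists s; rewrite {1}hE hu mpolyC0 add0r big1 ?add0r // => i _.
by rewrite mderiv_min ?scale0r // => v; rewrite hu.
Qed.

End SosConvex.

Lemma max_mlead (R : nzRingType) n (y : {mpoly R[n]}) (s : seq {mpoly R[n]}) :
  y \in s -> exists2 y0, y0 \in s & {in s, forall z, (mlead z <= mlead y0)%O}.
Proof.
elim: s y => // z [|z' s] IHs y _.
  by exists z => [|z0]; rewrite mem_seq1 // => /eqP ->.
have [y0 y0s y0max] := IHs z' (mem_head _ _).
have [zy0|/ltW y0z] := leP (mlead z) (mlead y0).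
  exists y0; first by rewrite inE y0s orbT.
  by move=> w; rewrite inE => /predU1P[->//|/y0max].
exists z; first exact: mem_head.
by move=> w; rewrite inE => /predU1P[->//|/y0max/le_trans]; apply.
Qed.

(** Let [M] be the largest leading monomial of the summands.  The coefficient of
[M + M] in the sum is the sum of the squares of the coefficients of [M], which
is positive; so [M + M] has degree at most [2 * k], and the order on monomials
compares degrees first. *)
Lemma degree_le_sum_sqr (R : realType) n (s : seq {mpoly R[n]}) k :
  degree_le (2 * k) (\sum_(y <- s) y ^+ 2) -> {in s, forall y, degree_le k y}.
Proof.
move=> s_deg y ys; have [y0 y0s y0max] := max_mlead ys.
rewrite /degree_le leqNgt; apply/negP => y_deg.
have y_neq0 : y != 0 by apply: contraTneq y_deg => ->; rewrite mmeasure0.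
set M := mlead y0.
have M_deg : (k < mdeg M)%N.
  have := lemc_mdeg (y0max y ys); apply: leq_trans.
  by rewrite -ltnS mlead_deg.
have y0_neq0 : y0 != 0.
  by apply: contraTneq M_deg => y00; rewrite /M y00 mlead0 mdeg0.
have : mcoeff (mnm_add M M) (\sum_(y <- s) y ^+ 2) = 0.
  apply: memN_msupp_eq0; apply: msize_mdeg_ge; apply: leq_trans s_deg _.
  by rewrite mdegD; lia.
rewrite raddf_sum /= big_seq.
under eq_bigr => z zs do
  rewrite expr2 (mleadcMW (y0max z zs) (y0max z zs)) -expr2.
rewrite -big_seq => /eqP; rewrite psumr_eq0 => [|z _]; last exact: sqr_ge0.
move=> /allP /(_ y0 y0s) /=; rewrite sqrf_eq0 /M.
by rewrite mleadc_eq0 (negPf y0_neq0).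
Qed.

Lemma continuous_peval (R : realType) n (p : {mpoly R[n]}) :
  continuous (peval p).
Proof.
elim/mpoly_ring_ind: p => [c|i|p q Pp Pq|p q Pp Pq] x; rewrite /peval.
- under eq_fun do rewrite mevalC; exact: cst_continuous.
- under eq_fun do rewrite mevalXU; exact: coord_continuous.
- under eq_fun do rewrite mevalD; exact: continuousD (Pp x) (Pq x).
- under eq_fun do rewrite mevalM; exact: continuousM (Pp x) (Pq x).
Qed.

(** * Lagrange polynomials *)

Section Lagrange.
Variables (R : realType) (n m : nat).
Implicit Types (f : {mpoly R[n]}) (g : 'I_m -> {mpoly R[n]}).

Lemma degree_leD d (p q : {mpoly R[n]}) :
  degree_le d p -> degree_le d q -> degree_le d (p + q).
Proof.
move=> pd qd; apply: leq_trans (mmeasureD_le _ _ _) _.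
by rewrite geq_max; apply/andP.
Qed.

Lemma degree_leZ d c (p : {mpoly R[n]}) : degree_le d p -> degree_le d (c *: p).
Proof. exact: leq_trans (mmeasureZ_le _ _ _). Qed.

Lemma degree_leC d c : degree_le d (mpolyC n c : {mpoly R[n]}).
Proof. by rewrite /degree_le mmeasureC; case: eqP. Qed.

Lemma degree_le_sum d (I : Type) (r : seq I) (F : I -> {mpoly R[n]}) :
  (forall i, degree_le d (F i)) -> degree_le d (\sum_(i <- r) F i).
Proof.
move=> Fd; elim/big_rec: _ => [|i p _ pd]; last exact: degree_leD.
by rewrite /degree_le mmeasure0.
Qed.

Lemma sos_sonc_ge0 k (p : {mpoly R[n]}) x : sos_sonc_cone k p -> 0 <= peval p x.
Proof.
move=> [u [v [[s [_ ->]] [[t [tP ->]] _] ->]]].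
rewrite /peval mevalD addr_ge0 ?meval_sum_sqr_ge0 // raddf_sum big_seq.
apply: sumr_ge0 => z /tP[z1 _ z2]; rewrite /= mevalZ mulr_ge0 //; exact: z2.
Qed.

Lemma lagrange_le d f g lambda x :
  multiplier_ge0 d lambda -> (forall j, 0 <= peval (g j) x <= 1) ->
  peval (Defs.lagrange d f g lambda) x <= peval f x.
Proof.
move=> lambda_ge0 gx; rewrite /Defs.lagrange /peval mevalB gerBl raddf_sum.
apply: sumr_ge0 => ab abd; rewrite /= mevalZ mulr_ge0 ?lambda_ge0 //.
rewrite rmorph_prod; apply: prodr_ge0 => j _ /=.
have /andP[g0 g1] := gx j.
by rewrite rmorphM !rmorphXn /= mevalB meval1 mulr_ge0 ?exprn_ge0 ?subr_ge0.
Qed.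

(** The multiplier [l j] sits at the index whose product is [g j] alone. *)
Definition linear_multiplier (l : 'I_m -> R) (a b : multinom m) : R :=
  if b == mnm0 then \sum_j l j * (a == mnm1 j)%:R else 0.

Lemma linear_multiplier_ge0 d l :
  (forall j, 0 <= l j) -> multiplier_ge0 d (linear_multiplier l).
Proof.
move=> l0 a b _; rewrite /linear_multiplier; case: ifP => // _.
by apply: sumr_ge0 => j _; rewrite mulr_ge0.
Qed.

Lemma lagrange_linear f g l :
  Defs.lagrange 1 f g (linear_multiplier l) = f - \sum_j l j *: g j.
Proof.
rewrite /Defs.lagrange; congr (_ - _).
pose G (ab : bmultinom m 2 * bmultinom m 2) : {mpoly R[n]} :=
  \prod_(j < m) (g j ^+ bmnm ab.1 j * (1 - g j) ^+ bmnm ab.2 j).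
transitivity (\sum_(ab : bmultinom m 2 * bmultinom m 2 |
    (mdeg (bmnm ab.1) + mdeg (bmnm ab.2) <= 1)%N)
    \sum_j (l j * ((bmnm ab.1 == mnm1 j) && (bmnm ab.2 == mnm0))%:R) *: G ab).
  apply: eq_bigr => ab _; rewrite -scaler_suml /linear_multiplier.
  case: eqP => _; first by under [in RHS]eq_bigr => j _ do rewrite andbT.
  by rewrite [X in _ = X *: _]big1 // => j _; rewrite andbF mulr0.
rewrite exchange_big; apply: eq_bigr => j _ /=.
have Uj : (mdeg (mnm1 j) < 2)%N by rewrite mdeg1.
have U0 : (mdeg (@mnm0 m) < 2)%N by rewrite mdeg0.
rewrite (bigD1 (BMultinom Uj, BMultinom U0)) /= ?mdeg1 ?mdeg0 //.
rewrite !eqxx mulr1 big1 ?addr0 => [|[a b] /andP[_ /eqP ab]].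
  congr (_ *: _); rewrite /G (bigD1 j) //= big1 => [|i /negPf ij].
    by rewrite mnm1E eqxx mnm0E mulr1 expr0 mulr1 expr1.
  by rewrite mnm1E eq_sym ij mnm0E !expr0 mulr1.
case: eqP => [aU|]; last by rewrite mulr0 scale0r.
case: eqP => [b0|]; last by rewrite mulr0 scale0r.
by case: ab; congr pair; apply: val_inj.
Qed.

End Lagrange.

Theorem corollary3p3 (R : realType) (n m k : nat)
  (f : {mpoly R[n]}) (g : 'I_m -> {mpoly R[n]})
  (K_nonempty : feasible_set g !=set0)
  (K_compact : compact (feasible_set g))
  (g_bounds : forall x, feasible_set g x ->
     forall j, 0 <= peval (g j) x <= 1)
  (g_generates : generates_algebra (range g `|` range (fun j => 1 - g j)))
  (slater : exists x0 : 'rV[R]_n, forall j, 0 < peval (g j) x0)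
  (f_sos_convex : sos_convex f)
  (f_degree : degree_le (2 * k) f)
  (g_sos_convex : forall j, sos_convex (- g j))
  (g_degree : forall j, degree_le (2 * k) (- g j)) :
  lagrange_bound 1 k f g = infimum_on (feasible_set g) f.
Proof.
have [u /set_mem Ku fmin] := EVT_min_rV K_nonempty K_compact
  (continuous_subspaceT (@continuous_peval R n f)).
have {}fmin x : feasible_set g x -> peval f u <= peval f x.
  by move=> Kx; apply: fmin; rewrite inE.
have [x0 gx0] := slater.
(* Duality applied to [f - f(u)], nonnegative wherever all the [- g j] are
   nonpositive. *)
have [||||||l l_ge0 l_mult] := @slater_multipliers R 'rV[R]_n m setT
  (fun x => peval f x - peval f u) (fun j => peval (- g j)) x0.
- by move=> x y t; rewrite !inE.
- have := sos_convex_convex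
    (sos_convexD f_sos_convex (sos_convexC n (- peval f u))).
  rewrite (_ : peval _ = fun x => peval f x - peval f u) //.
  by apply/funext => x; rewrite /peval mevalD mevalC.
- by move=> j; exact: sos_convex_convex.
- by [].
- by move=> j; rewrite /peval mevalN oppr_lt0; exact: gx0.
- move=> x _ hx; rewrite subr_ge0; apply: fmin => j.
  by have := hx j; rewrite /peval mevalN oppr_le0.
pose L : {mpoly R[n]} := f + \sum_j l j *: (- g j) + mpolyC n (- peval f u).
have LE x : peval L x = peval f x - peval f u + \sum_j l j * peval (- g j) x.
  rewrite /peval !mevalD mevalC raddf_sum addrAC; congr (_ + _).
  by apply: eq_bigr => j _; rewrite /= mevalZ.
have L_ge0 v : 0 <= meval v L.
  rewrite (_ : meval v L = peval L (\row_i v i)).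
    by rewrite LE l_mult.
  by apply: meval_eq => i; rewrite mxE.
have L_u : meval (u ord0) L = 0.
  (* Each [l j * g j u] is nonnegative, so [L] is nonpositive at [u]. *)
  apply/eqP; rewrite eq_le L_ge0 andbT -/(peval L u) LE subrr add0r.
  apply: sumr_le0 => j _; rewrite mulr_ge0_le0 // /peval mevalN oppr_le0.
  exact: Ku.
have L_convex : sos_convex L.
  apply: sos_convexD (sos_convexC _ _); apply: sos_convexD => //.
  by apply: sos_convex_sum => j; exact: sos_convexZ.
have L_degree : degree_le (2 * k) L.
  apply: degree_leD (degree_leC _ _ _); apply: degree_leD => //.
  by apply: degree_le_sum => j; exact: degree_leZ.
have [s sE] := sos_convex_min_sos L_convex L_u L_ge0.
have L_cone : sos_sonc_cone k (Defs.lagrange 1 f g (linear_multiplier l)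
    - mpolyC n (peval f u)).
  exists L, 0; split.
  - by exists s; split=> //; apply: degree_le_sum_sqr; rewrite -sE.
  - split; last by rewrite /degree_le mmeasure0.
    by exists [::]; rewrite big_nil.
  rewrite addr0 lagrange_linear /L mpolyCN -sumrN; congr (_ + _ - _).
  by apply: eq_bigr => j _; rewrite scalerN.
have -> : infimum_on (feasible_set g) f = (peval f u)%:E.
  apply/eqP; rewrite eq_le ereal_inf_lbound; last by exists u.
  by apply: le_ereal_inf_tmp => _ [x Kx <-]; rewrite lee_fin fmin.
apply/eqP; rewrite eq_le; apply/andP; split.
  apply: ge_ereal_sup => _ [t [lambda [lambda_ge0 t_cone]] <-]; rewrite lee_fin.
  apply: le_trans (lagrange_le f lambda_ge0 (g_bounds u Ku)).
  by have := sos_sonc_ge0 u t_cone; rewrite /peval mevalB mevalC subr_ge0.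
apply: ereal_sup_ubound; exists (peval f u) => //.
exists (linear_multiplier l); split=> //.
exact: linear_multiplier_ge0.
Qed.
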